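(* Let $[\mathfrak f;\mathbf M]$ be the TOTEMplex determined by the empirical distribution $\mathfrak f$ and the irreducible vector operator $\mathbf M=(m_1,\dots,m_D)$ over the admissible configurations $\mathcal D_\star$, and let $\upsilon$ be a reference distribution on $\mathcal D$ with $\upsilon_e>0$ for all $e\in\mathcal D_\star$. Then there exists a unique distribution $\mathfrak q\in[\mathfrak f;\mathbf M]$ such that $$D(\mathfrak q\,\|\,\upsilon)\le D(\mathfrak p\,\|\,\upsilon)\qquad\text{for all }\mathfrak p\in[\mathfrak f;\mathbf M].$$
   Context: $\mathcal D=\mathcal D_1\times\dots\times\mathcal D_L$ is a finite set of configurations (a product of finite attribute domains) and $\mathcal D_\star\subseteq\mathcal D$ is the nonempty subset of admissible configurations. A probability distribution on a set is identified with its vector of probabilities; $\mathcal P(\mathcal D_\star)$ is the simplex of $\mathfrak p=(p_e)_{e\in\mathcal D_\star}$ with $p_e\ge 0$ and $\sum_{e} p_e=1$. The empirical distribution $\mathfrak f$ is a probability distribution on $\mathcal D$ with $f_e=0$ for $e\notin\mathcal D_\star$. An irreducible vector operator $\mathbf M$ over $\mathcal D_\star$ is a tuple $(m_1,\dots,m_D)$ of linearly independent functions $m_\alpha:\mathcal D_\star\to\mathbb R$; by convention the constant function $1$ always lies in the linear span of $m_1,\dots,m_D$ (normalization). The TOTEMplex is $$[\mathfrak f;\mathbf M]=\Big\{\mathfrak p\in\mathcal P(\mathcal D_\star):\ \sum_{e\in\mathcal D_\star}m_\alpha(e)\,p_e=\sum_{e\in\mathcal D_\star}m_\alpha(e)\,f_e\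 \text{ for }\alpha=1,\dots,D\Big\}.$$ The $I$-divergence is $D(\mathfrak p\|\upsilon)=\sum_{e\in\mathcal D_\star}p_e\log\frac{p_e}{\upsilon_e}$, with $0\log 0=0$. The reference $\upsilon$ is a probability distribution on $\mathcal D$ and need not lie in $[\mathfrak f;\mathbf M]$ nor vanish outside $\mathcal D_\star$. *)

(* Defs.v *)
From HB Require Import structures.
From mathcomp Require Import all_boot all_order all_algebra.
From mathcomp Require Import reals exp.

Set Implicit Arguments.
Unset Strict Implicit.
Unset Printing Implicit Defensive.

Import Order.TTheory GRing.Theory Num.Theory.
Local Open Scope ring_scope.

(* The product of the attribute domains A 0, ..., A (L - 1). *)
Notation config A := {dffun forall l, A l}.

Notation admissible Dstar := {e | e \in Dstar}.

Section Totem.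
Variable R : realType.

Definition distribution (T : finType) (p : {ffun T -> R}) : Prop :=
  (forall e, 0 <= p e) /\ \sum_e p e = 1.

Variables (L : nat) (A : 'I_L -> finType) (Dstar : {set config A}).

(* The second conjunct is the normalization convention: the constant function
   1 lies in the span.  The codomain R^o is R viewed as a vector space over
   itself, so that [free] and span apply to functions. *)
Definition irreducible_vector_operator (D : nat)
    (M : D.-tuple {ffun admissible Dstar -> R^o}) : Prop :=
  free M /\ [ffun => 1 : R^o] \in <<M>>%VS.

Definition totemplex (D : nat) (f : {ffun config A -> R})
    (M : D.-tuple {ffun admissible Dstar -> R^o})
    (p : {ffun admissible Dstar -> R}) : Prop :=
  distribution p /\
  forall alpha : 'I_D,
    \sum_(e : admissible Dstar) (tnth M alpha e : R) * p e =
    \sum_(e : admissible Dstar) (tnth M alpha e : R) * f (val e).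

(* Terms with p e = 0 vanish whatever the value of [ln 0], which gives
   0 log 0 = 0.  The formula is only meaningful when v is positive on Dstar:
   division by zero is total here, and no value +oo is produced. *)
Definition I_divergence (p : {ffun admissible Dstar -> R})
    (v : {ffun config A -> R}) : R :=
  \sum_(e : admissible Dstar) p e * ln (p e / v (val e)).

End Totem.

(* Main.v *)
From HB Require Import structures.
From mathcomp Require Import all_boot all_order all_algebra ring lra.
From mathcomp Require Import boolp classical_sets functions reals exp.
From mathcomp Require Import topology normedtype realfun derive.
From mathcomp Require Import finset.
Require Import Defs.

(** The minimizer exists because a continuous function attains its minimum on
    a nonempty compact set, and it is unique because the I-divergence is
    strictly convex.

    With w the restriction of the reference to the admissible configurations,
    the I-divergence is a finite sum of terms x ln (x / w_e).  The function
    x ln x is continuous on the whole line, 0 included, since |x ln x| is at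
    most 2 sqrt x on ]0, 1[ ([continuous_xlnx]); so the divergence is
    continuous.  The TOTEMplex is cut out of the probability simplex by linear
    equations, so it is closed in a compact set ([simplex_compact],
    [moment_polytope_closed]), and it contains the empirical distribution,
    whose mass lies on the admissible configurations.  This gives existence
    ([I_projection_exists]).

    Uniqueness only needs convexity at midpoints.  If q and p were distinct
    minimizers, their midpoint would again lie in the TOTEMplex
    ([moment_polytope_midpoint]) and have a strictly smaller divergence
    ([divergence_midpoint_lt]).  The strict inequality comes, coordinate by
    coordinate, from x ln (x / y) > x - y for x <> y, which is where the graph
    of x ln x lies strictly above its tangent at y ([xlnx_tangent_lt]).  That
    inequality holds at x = 0 as well, so minimizers with zero probabilities
    are covered. *)

Set Implicit Arguments.
Unset Strict Implicit.
Unset Printing Implicit Defensive.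

Import Order.TTheory GRing.Theory Num.Theory.
Import numFieldNormedType.Exports.
Local Open Scope ring_scope.

(** * The function x ln x *)

Section Pointwise.
Local Open Scope classical_set_scope.
Variable R : realType.
Implicit Types a b c x y : R.

(** For x > 0 this is 1 + t < exp t at t = ln (y / x), multiplied by x; the
    condition x <> y is what makes t nonzero.  For x = 0 it reads - y < 0. *)
Lemma xlnx_tangent_lt x y : 0 <= x -> 0 < y -> x != y ->
  x - y < x * ln (x / y).
Proof.
rewrite le_eqVlt => /predU1P[<- y_gt0 _|x_gt0 y_gt0 xy].
  by rewrite mul0r sub0r oppr_lt0.
have lnyx_neq0 : ln (y / x) != 0.
  rewrite ln_eq0 ?divr_gt0//; apply: contra xy => /eqP yx1.
  by rewrite -[y](divfK (lt0r_neq0 x_gt0)) yx1 mul1r.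
have := expR_gt1Dx lnyx_neq0; rewrite lnK ?posrE ?divr_gt0//.
rewrite -(ltr_pM2l x_gt0) mulrCA divff ?lt0r_neq0// mulr1 mulrDr mulr1.
by rewrite ln_div ?posrE// -[ln y - _]opprB -ln_div ?posrE// mulrN; lra.
Qed.

Lemma xlnx_change_reference x y c : 0 <= x -> 0 < y -> 0 < c ->
  x * ln (x / c) = x * ln (x / y) + x * ln (y / c).
Proof.
rewrite le_eqVlt => /predU1P[<- *|x_gt0 y_gt0 c_gt0].
  by rewrite !mul0r addr0.
by rewrite !ln_div ?posrE//; ring.
Qed.

(** Adding the tangent inequalities of the two points at their midpoint s
    cancels the linear parts, since (a - s) + (b - s) = 0.  The constant c
    contributes only a linear term, by the change of reference from c to s. *)
Lemma xlnx_midpoint_lt a b c : 0 <= a -> 0 <= b -> 0 < c -> a != b ->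
  2 * ((a + b) / 2 * ln ((a + b) / 2 / c)) <
  a * ln (a / c) + b * ln (b / c).
Proof.
move=> a_ge0 b_ge0 c_gt0 ab; set s := (a + b) / 2.
have sE : 2 * s = a + b by rewrite /s; field.
have s_gt0 : 0 < s.
  (* The midpoint of nonnegative numbers vanishes only if both do. *)
  suff : s != 0 by move=> s_neq0; rewrite lt_neqAle eq_sym s_neq0 /s; lra.
  by apply: contra ab => /eqP s0; apply/eqP; lra.
have as_neq : a != s by apply: contra ab => /eqP a_s; apply/eqP; lra.
have bs_neq : b != s by apply: contra ab => /eqP b_s; apply/eqP; lra.
have := xlnx_tangent_lt a_ge0 s_gt0 as_neq.
have := xlnx_tangent_lt b_ge0 s_gt0 bs_neq.
rewrite (xlnx_change_reference a_ge0 s_gt0 c_gt0).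
rewrite (xlnx_change_reference b_ge0 s_gt0 c_gt0).
rewrite mulrA sE mulrDl; lra.
Qed.

Lemma xlnx_midpoint_le a b c : 0 <= a -> 0 <= b -> 0 < c ->
  2 * ((a + b) / 2 * ln ((a + b) / 2 / c)) <=
  a * ln (a / c) + b * ln (b / c).
Proof.
move=> a_ge0 b_ge0 c_gt0; have [<-|ab] := eqVneq a b.
  have -> : (a + a) / 2 = a by field.
  by rewrite mulrDl !mul1r.
exact/ltW/xlnx_midpoint_lt.
Qed.

(** Writing x = s ^ 2 turns - x ln x into 2 s ^ 2 ln (1 / s), and ln (1 / s) is
    less than 1 / s.  For x <= 0 both sides are 0, as [ln] and the square root
    are extended by 0. *)
Lemma norm_xlnx_le_sqrt x : x < 1 -> `|x * ln x| <= 2 * Num.sqrt x.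
Proof.
move=> x_lt1; have [x_le0|x_gt0] := leP x 0.
  by rewrite ln0// mulr0 normr0 mulr_ge0// sqrtr_ge0.
set s := Num.sqrt x; have s_gt0 : 0 < s by rewrite sqrtr_gt0.
have xE : x = s ^+ 2 by rewrite sqr_sqrtr// ltW.
have lnx_le0 : ln x <= 0 by rewrite ln_le0// ltW.
rewrite ler0_norm; last by rewrite mulr_ge0_le0// ltW.
have /ltW : ln s^-1 < s^-1 by rewrite ln_sublinear// invr_gt0.
rewrite lnV ?posrE// => lns.
have : s ^+ 2 * - ln s <= s ^+ 2 * s^-1.
  by rewrite ler_wpM2l// sqr_ge0.
rewrite expr2 mulfK ?lt0r_neq0// xE lnXn// -expr2 mulr2n; lra.
Qed.

(** Since [ln] is 0 on the negative half-line, continuity holds on all of R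
    and not merely on the nonnegative half-line; this lets the divergence be
    treated as a continuous function on the whole space. *)
Lemma continuous_xlnx : continuous (fun x : R => x * ln x).
Proof.
move=> x; have [x_lt0|x_gt0|->] := ltgtP x 0.
- apply: (near_cst_continuous 0); near=> y.
  by rewrite ln0 ?mulr0// ltW//; near: y; exact: (cvgr_lt x).
- by apply: continuousM; [exact: cvg_id|exact: continuous_ln].
rewrite /continuous_at mul0r.
apply/norm_cvg0P.
apply: (@squeeze_cvgr _ _ _ _ (cst 0) (fun y : R => 2 * Num.sqrt y)).
- near=> y; rewrite normr_ge0 norm_xlnx_le_sqrt//.
  by near: y; exact: (cvgr_lt (0 : R)).
- exact: cvg_cst.
- have : 2 * Num.sqrt y @[y --> (0 : R)] --> 2 * Num.sqrt 0.
    by apply: cvgM; [exact: cvg_cst|exact: sqrt_continuous].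
  by rewrite sqrtr0 mulr0.
Unshelve. all: by end_near. Qed.

End Pointwise.

(** * Divergence minimization on closed subsets of the simplex *)

Section IProjection.
Local Open Scope classical_set_scope.
Variables (R : realType) (T : finType).
Local Notation V := {ptws T -> R}.
Local Notation divergence w p := (\sum_e p e * ln (p e / w e)).

Lemma continuous_coordinate e : continuous (fun p : V => p e).
Proof. exact: (@proj_continuous T (fun=> R) e). Qed.

Lemma continuous_linear_form (m : T -> R) :
  continuous (fun p : V => \sum_e m e * p e).
Proof.
apply: continuous_big; first exact: add_continuous.
move=> e _ p; apply: (@cvgMl_tmp R _ (nbhs p) _ (fun p => p e)).
exact: continuous_coordinate.
Qed.

Lemma continuous_divergence (w : T -> R) : (forall e, 0 < w e) ->
  continuous (fun p : V => divergence w p).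
Proof.
move=> w_gt0; apply: continuous_big; first exact: add_continuous.
move=> e _ p.
(* p ln (p / w) = w ((p / w) ln (p / w)) is a rescaling of x ln x. *)
have -> : (fun p : V => p e * ln (p e / w e)) =
    (fun t => w e * (t / w e * ln (t / w e))) \o (fun p => p e).
  by apply/funext => q /=; rewrite mulrA mulrCA divff ?mulr1// lt0r_neq0.
apply: (@continuous_comp V R R); first exact: continuous_coordinate.
apply: (@cvgMl_tmp R).
apply: (@continuous_comp R R R (fun t => t / w e) (fun t => t * ln t)).
  by apply: cvgMr_tmp; exact: cvg_id.
exact: continuous_xlnx.
Qed.

Lemma closed_linear_level (m : T -> R) (b : R) :
  closed [set p : V | \sum_e m e * p e = b].
Proof.
have /continuous_closedP := @continuous_linear_form m.
by move/(_ _ (@closed_eq R b)).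
Qed.

Definition simplex : set V :=
  [set p | (forall e, 0 <= p e) /\ \sum_e p e = 1].

Lemma simplex_closed : closed simplex.
Proof.
(* The sum condition is the level set at 1 of the linear form with constant
   coefficients 1. *)
have -> : simplex = \bigcap_e [set p : V | 0 <= p e] `&`
    [set p | \sum_e 1 * p e = 1].
  have sum1E (p : V) : \sum_e 1 * p e = \sum_e p e.
    by apply: eq_bigr => e _; rewrite mul1r.
  apply/seteqP; split=> p [p_ge0 p_sum]; split=> [e|] /=.
  - by move=> _; exact: p_ge0.
  - by rewrite sum1E.
  - exact: p_ge0.
  - by rewrite -sum1E.
apply: closedI; last exact: closed_linear_level.
apply: closed_bigI => e _.
have /continuous_closedP := @continuous_coordinate e.
by move/(_ _ (@closed_ge R 0)).
Qed.

(** The cube of functions from T to the unit interval is compact by the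
    Tychonoff theorem, and the simplex is a closed subset of it: a nonnegative coordinate is at most the sum. *)
Lemma simplex_compact : compact simplex.
Proof.
have cube_compact := @tychonoff T (fun=> R) (fun=> `[0, 1])
  (fun=> @segment_compact R 0 1).
apply: (subclosed_compact simplex_closed cube_compact) => p [p_ge0 p_sum] e.
rewrite /= in_itv/= p_ge0/= -p_sum (bigD1 e)//=.
by rewrite lerDl sumr_ge0.
Qed.

(** A closed subset of the simplex is compact, so the continuous divergence
    attains its minimum on it. *)
Lemma I_projection_exists (K : set V) (w : T -> R) :
  (forall e, 0 < w e) -> closed K -> K `<=` simplex -> K !=set0 ->
  exists2 q, K q & forall p, K p -> divergence w q <= divergence w p.
Proof.
move=> w_gt0 K_closed K_sub K_neq0.
have K_compact := subclosed_compact K_closed simplex_compact K_sub.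
have [q /set_mem Kq q_min] := compact_EVT_min K_neq0 K_compact
  (continuous_subspaceT (continuous_divergence w_gt0)).
by exists q => // p /mem_set; exact: q_min.
Qed.

(** One coordinate where p and q differ gives a strict inequality; the other
    terms only need convexity in the weak sense. *)
Lemma divergence_midpoint_lt (w p q : T -> R) :
  (forall e, 0 < w e) -> (forall e, 0 <= p e) -> (forall e, 0 <= q e) ->
  (exists e, p e != q e) ->
  2 * divergence w (fun e => (p e + q e) / 2) <
  divergence w p + divergence w q.
Proof.
move=> w_gt0 p_ge0 q_ge0 [e pq_e]; rewrite mulr_sumr -big_split/=.
rewrite (bigD1 e)//= [ltRHS](bigD1 e)//= ltr_leD//.
  exact: xlnx_midpoint_lt.
by apply: ler_sum => i _; exact: xlnx_midpoint_le.
Qed.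

(** * Distributions with prescribed moments *)

Section MomentPolytope.
Variables (I : Type) (m : I -> T -> R) (b : I -> R).

Definition moment_polytope : set V :=
  simplex `&` \bigcap_i [set p : V | \sum_e m i e * p e = b i].

Lemma moment_polytope_closed : closed moment_polytope.
Proof.
apply: closedI; first exact: simplex_closed.
by apply: closed_bigI => i _; exact: closed_linear_level.
Qed.

Lemma moment_polytope_midpoint (p q : V) :
  moment_polytope p -> moment_polytope q ->
  moment_polytope (fun e => (p e + q e) / 2).
Proof.
move=> [[p_ge0 p_sum] p_mom] [[q_ge0 q_sum] q_mom].
have halfD (x : R) : (x + x) / 2 = x by field.
split=> [|i _ /=].
  split=> [e|]; first by rewrite divr_ge0// addr_ge0.
  by rewrite -mulr_suml big_split/= p_sum q_sum halfD.
under eq_bigr do rewrite mulrA mulrDr.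
by rewrite -mulr_suml big_split/= (p_mom i)// (q_mom i)// halfD.
Qed.

End MomentPolytope.

End IProjection.

Theorem theorem3p1 (R : realType) (L : nat) (A : 'I_L -> finType)
    (Dstar : {set config A}) (Dstar_neq0 : Dstar != set0)
    (f : {ffun config A -> R}) (f_distr : distribution f)
    (f_supp : forall e, e \notin Dstar -> f e = 0)
    (D : nat) (M : D.-tuple {ffun admissible Dstar -> R^o})
    (M_irr : irreducible_vector_operator M)
    (v : {ffun config A -> R}) (v_distr : distribution v)
    (v_gt0 : forall e, e \in Dstar -> 0 < v e) :
  exists! q : {ffun admissible Dstar -> R},
    totemplex f M q /\
    forall p : {ffun admissible Dstar -> R},
      totemplex f M p -> I_divergence q v <= I_divergence p v.
Proof.
have w_gt0 (e : admissible Dstar) : 0 < v (val e) by apply: v_gt0; exact: valP.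
pose m (alpha : 'I_D) (e : admissible Dstar) : R := tnth M alpha e.
pose K := moment_polytope m (fun alpha => \sum_e m alpha e * f (val e)).
have KE (p : {ffun admissible Dstar -> R}) : totemplex f M p <-> K p.
  by split=> -[p_distr p_mom]; split=> // alpha; [move=> _|]; exact: p_mom.
(* No mass of f is lost by restricting it to the admissible configurations. *)
have Kf : K (fun e => f (val e)).
  case: f_distr => f_ge0 f_sum; split=> //; split=> //.
  rewrite -[RHS]f_sum [RHS](bigID (mem Dstar))/= [X in _ + X]big1 ?addr0//.
  by rewrite (big_sub Dstar f).
have [q Kq q_min] := I_projection_exists w_gt0
  (@moment_polytope_closed _ _ _ _ _) (@subIsetl _ _ _) (ex_intro _ _ Kf).
pose q' := [ffun e => q e].
have q'E : q' = q :> (_ -> R) by apply/funext => e; rewrite ffunE.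
exists q'; split=> [|p [/KE Kp p_min]].
  split=> [|p /KE Kp]; first by apply/KE; rewrite q'E.
  by rewrite /I_divergence q'E; exact: q_min.
(* Two distinct minimizers would be beaten by their midpoint. *)
apply/ffunP => e; apply/eqP/contraT => qp_e.
have [[[q_ge0 _] _] [[p_ge0 _] _]] := (Kq, Kp).
have qp_neq : exists e, q e != p e by exists e; rewrite -q'E.
have p_le_q : I_divergence p v <= I_divergence q' v.
  by apply: p_min; apply/KE; rewrite q'E.
rewrite /I_divergence q'E in p_le_q.
have := divergence_midpoint_lt w_gt0 q_ge0 p_ge0 qp_neq.
have /q_min := moment_polytope_midpoint Kq Kp.
by move: p_le_q => /=; lra.
Qed.
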